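(* Let $n\ge 1$ and $N\ge 1$ be integers and let $c_{i,j_1,\ldots,j_{n+1}}$ ($1\le i\le N$, $0\le j_1\le\cdots\le j_{n+1}\le N$) be arbitrary coefficients. Put $x^{(k)}=(x^{(k)}_1,\ldots,x^{(k)}_N)$ and $x_0^{(k)}=1$ for all $k$, and with time step $h$ consider the system of equations $$\frac{1}{h^n}\sum_{k=0}^n(-1)^{n-k}\binom{n}{k}x_i^{(k)}=\frac{1}{(n+1)!}\sum_{\sigma\in S_{n+1}}\ \sum_{0\le j_1\le\cdots\le j_{n+1}\le N}c_{i,j_1,\ldots,j_{n+1}}\,x^{(0)}_{j_{\sigma(1)}}x^{(1)}_{j_{\sigma(2)}}\cdots x^{(n)}_{j_{\sigma(n+1)}},\qquad i=1,\ldots,N.$$ This system is linear in each of the highest shifts $x^{(n)}_1,\ldots,x^{(n)}_N$, so it can be explicitly solved for each of these quantities to yield rational functions of all the lower shifts $x^{(0)},\ldots,x^{(n-1)}$. It is also linear in each of the lowest shifts $x^{(0)}_1,\ldots,x^{(0)}_N$, so it can be explicitly solved for these as well. Thus the system is an implicit way of writing an explicit birational map in dimension $nN$, corresponding to $$(x^{(0)},x^{(1)},\ldots,x^{(n-1)})\mapsto(x^{(1)},x^{(2)},\ldots,x^{(n)}).$$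
   Context: The system is a discretization, with time step $h$, of the system of $n$th order ODEs $\frac{d^n x_i}{dt^n}=\sum_{0\le j_1\le\cdots\le j_{n+1}\le N}c_{i,j_1,\ldots,j_{n+1}}x_{j_1}\cdots x_{j_{n+1}}$, $i=1,\ldots,N$, where $x_0=1$ is a dummy variable (so that the right-hand sides are polynomials of degree at most $n+1$ in $x_1,\ldots,x_N$). Here $x_i^{(k)}$ stands for the approximation to $x_i(t+kh)$, with $x_i^{(0)}=x_i$, and $S_{n+1}$ is the symmetric group on $n+1$ symbols. The left-hand side of the system is the $n$th power of the forward difference operator $\Delta x_i=(x_i^{(1)}-x_i^{(0)})/h$ applied to $x_i$. A birational map is a rational map with a rational inverse.
   Formalization: Solvability and birationality are proved for all nonzero time steps h outside a finite set depending on the coefficients (any field of characteristic 0); for special h the claim fails, e.g. n=N=1, x'=ax, ha=2, where the highest shift cancels. *)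

(* Defs.v *)
From HB Require Import structures.
From mathcomp Require Import all_boot all_order all_fingroup all_algebra.
From mathcomp Require Import mpoly.

Set Implicit Arguments.
Unset Strict Implicit.
Unset Printing Implicit Defensive.

Import GRing.Theory.
Local Open Scope ring_scope.

Section RationalMaps.
Variables (F : fieldType) (d : nat).

Definition ratfun : fieldType := {fraction {mpoly F[d]}}.

Definition ratpoly (p : {mpoly F[d]}) : ratfun := FracField.tofrac p.

Definition ratconst (a : F) : ratfun := ratpoly a%:MP.

Definition ratvar (v : 'I_d) : ratfun := ratpoly 'X_v.

(* The value of a polynomial in e variables at a point whose coordinates are
   rational functions in d variables. *)
Definition poly_at (e : nat) (p : {mpoly F[e]}) (phi : 'rV[ratfun]_e) : ratfun :=
  mmap ratconst (fun v => phi 0 v) p.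

End RationalMaps.

(* A rational map of affine d-space to itself is the row of its components.
   The composite f \o phi is undefined when the denominator of f vanishes
   identically on the image of phi, whence a relation: f \o phi is defined and
   equal to g. It does not depend on the fraction p / q representing f. *)
Definition ratcomp_is (F : fieldType) (d : nat)
    (f : ratfun F d) (phi : 'rV[ratfun F d]_d) (g : ratfun F d) : Prop :=
  exists p q : {mpoly F[d]},
    [/\ f = ratpoly p / ratpoly q,
        poly_at q phi != 0
      & g = poly_at p phi / poly_at q phi].

Definition rational_inverse (F : fieldType) (d : nat)
    (phi psi : 'rV[ratfun F d]_d) : Prop :=
  (forall v, ratcomp_is (psi 0 v) phi (ratvar F v)) /\
  (forall v, ratcomp_is (phi 0 v) psi (ratvar F v)).

Definition birational (F : fieldType) (d : nat) (phi : 'rV[ratfun F d]_d) : Prop :=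
  exists psi, rational_inverse phi psi.

Section DiscreteSystem.
Variables (F : fieldType) (n N : nat).

(* The n.+1 * N indeterminates x^(k)_i, k = 0 .. n, where i : 'I_N stands for
   the index i + 1 in 1 .. N. *)
Definition shift_var (k : 'I_n.+1) (i : 'I_N) : {mpoly F[n.+1 * N]} :=
  'X_(mxvec_index k i).

(* x^(k)_j for j = 0 .. N, where j = 0 is the dummy variable x^(k)_0 = 1. *)
Definition shift_var0 (k : 'I_n.+1) (j : 'I_N.+1) : {mpoly F[n.+1 * N]} :=
  if unlift ord0 j is Some i then shift_var k i else 1.

Definition nondecr (j : {ffun 'I_n.+1 -> 'I_N.+1}) : bool :=
  [forall a : 'I_n.+1, forall b : 'I_n.+1, (a <= b)%N ==> (j a <= j b)%N].

Definition diff_lhs (h : F) (i : 'I_N) : {mpoly F[n.+1 * N]} :=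
  (h ^+ n)^-1 *:
    \sum_(k < n.+1) ((-1) ^+ (n - k) * 'C(n, k)%:R) *: shift_var k i.

(* Only the values of c at nondecreasing multi-indices matter. *)
Definition polarized_rhs (c : 'I_N -> {ffun 'I_n.+1 -> 'I_N.+1} -> F) (i : 'I_N)
    : {mpoly F[n.+1 * N]} :=
  ((n.+1)`!%:R)^-1 *:
    \sum_(s : 'S_n.+1) \sum_(j : {ffun 'I_n.+1 -> 'I_N.+1} | nondecr j)
      c i j *: \prod_(k < n.+1) shift_var0 k (j (s k)).

(* Total degree at most 1 in x^(k)_1, .., x^(k)_N taken together, the other
   shifts being regarded as coefficients. *)
Definition linear_in_shift (k : 'I_n.+1) (p : {mpoly F[n.+1 * N]}) : Prop :=
  forall m, m \in msupp p -> (\sum_(i < N) m (mxvec_index k i) <= 1)%N.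

(* Row k of x is x^(k), with entries in the field of rational functions.
   For special values of h the system degenerates: with n = N = 1 and
   right-hand side a * (x^(0) + x^(1)) / 2, the unknown x^(1) cancels out when
   h * a = 2. *)
Definition solves (c : 'I_N -> {ffun 'I_n.+1 -> 'I_N.+1} -> F) (h : F)
    (x : 'M[ratfun F (n * N)]_(n.+1, N)) : Prop :=
  forall i, poly_at (diff_lhs h i) (mxvec x) = poly_at (polarized_rhs c i) (mxvec x).

(* The generic point of affine space of dimension n * N, as n rows of N
   independent coordinates. *)
Definition generic_rows : 'M[ratfun F (n * N)]_(n, N) :=
  \matrix_(k, i) ratvar F (mxvec_index k i).

(* All shifts but the highest: x^(0), .., x^(n-1). *)
Definition lower_shifts (R : Type) (x : 'M[R]_(n.+1, N)) : 'M[R]_(n, N) :=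
  row' ord_max x.

(* All shifts but the lowest: x^(1), .., x^(n). *)
Definition upper_shifts (R : Type) (x : 'M[R]_(n.+1, N)) : 'M[R]_(n, N) :=
  row' ord0 x.

End DiscreteSystem.

(* Main.v *)
Require Import Defs.
From HB Require Import structures.
From mathcomp Require Import all_boot all_order all_fingroup all_algebra.
From mathcomp Require Import mpoly ring.
From Stdlib Require Import Classical.

Set Implicit Arguments.
Unset Strict Implicit.
Unset Printing Implicit Defensive.

Import GRing.Theory.
Local Open Scope ring_scope.

(** After multiplication by [t = h^n] the system is polynomial in [t] and affine
    in each row [x^(k)], so row [k] is determined by the others through Cramer's
    rule as soon as the determinant of the step does not vanish; the inverse of
    the forward map is then the backward step, provided the backward determinant
    does not vanish identically on the image of the forward map.  Clearing the
    denominators of the forward solution, which is possible because the backward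
    matrix is affine in [x^(n)], turns this into the nonvanishing of a polynomial.
    It suffices to evaluate that polynomial where all free shifts are 0: the value
    is a polynomial in [h], and at [h = 0] it is a product of powers of the
    coefficients of the difference operator, which are nonzero in
    characteristic 0.  The excluded [h] are its roots. *)

(** * Functions affine in a row vector *)

Section AffineRow.
Variables (R : comNzRingType) (N : nat).
Implicit Types (f g : 'rV[R]_N -> R) (r : 'rV[R]_N).

(** Affinity is read off from the values at 0 and at the unit rows, the same data that fill
    [step_cst] and [step_mx] below. *)
Definition affine_row f :=
  forall r, f r = f 0 + \sum_j r 0 j * (f (delta_mx 0 j) - f 0).

Lemma eq_affine_row f g : f =1 g -> affine_row g -> affine_row f.
Proof.
move=> fg gA r; rewrite !fg gA; congr (_ + _).
by apply: eq_bigr => j _; rewrite !fg.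
Qed.

Lemma affine_row_const a f : (forall r, f r = a) -> affine_row f.
Proof. by move=> fE r; rewrite big1 ?addr0 ?fE // => j _; rewrite !fE subrr mulr0. Qed.

Lemma affine_row_coord i f : (forall r, f r = r 0 i) -> affine_row f.
Proof.
move=> fE r; rewrite !fE mxE add0r (bigD1 i) //= big1 ?addr0 => [|j /negPf ji].
  by rewrite !fE !mxE !eqxx subr0 mulr1.
by rewrite !fE !mxE eqxx eq_sym ji subr0 mulr0.
Qed.

Lemma affine_rowM f g : (forall r, f r = f 0) -> affine_row g ->
  affine_row (fun r => f r * g r).
Proof.
move=> fE gA r; rewrite !fE [in LHS]gA mulrDr mulr_sumr; congr (_ + _).
by apply: eq_bigr => j _; rewrite [f (delta_mx _ _)]fE -mulrBr mulrCA.
Qed.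

Lemma affine_rowB f g : affine_row f -> affine_row g ->
  affine_row (fun r => f r - g r).
Proof.
move=> fA gA r; rewrite [in LHS]fA [in LHS]gA opprD addrACA -sumrB; congr (_ + _).
by apply: eq_bigr => j _; rewrite -mulrBr; congr (_ * _); ring.
Qed.

Lemma affine_row_sum (I : Type) (s : seq I) (P : pred I) (f : I -> 'rV[R]_N -> R) :
  (forall i, affine_row (f i)) -> affine_row (fun r => \sum_(i <- s | P i) f i r).
Proof.
move=> fA r; rewrite (eq_bigr _ (fun i _ => fA i r)) big_split /= exchange_big /=.
by congr (_ + _); apply: eq_bigr => j _; rewrite -sumrB mulr_sumr.
Qed.

End AffineRow.

(** * Inserting one row among the others *)

Section Glue.
Variables (T : Type) (n N : nat).

Definition glue (k : 'I_n.+1) (Y : 'M[T]_(n, N)) (r : 'rV[T]_N) : 'M[T]_(n.+1, N) :=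
  \matrix_(a, i) if unlift k a is Some b then Y b i else r 0 i.

Lemma glue_lift k Y r b i : glue k Y r (lift k b) i = Y b i.
Proof. by rewrite mxE liftK. Qed.

Lemma glue_at k Y r i : glue k Y r k i = r 0 i.
Proof. by rewrite mxE unlift_none. Qed.

Lemma row'_glue k Y r : row' k (glue k Y r) = Y.
Proof. by apply/matrixP=> b i; rewrite mxE glue_lift. Qed.

Lemma glue_row' k X : glue k (row' k X) (row k X) = X.
Proof.
by apply/matrixP=> a i; rewrite mxE; case: unliftP => [b ->|->]; rewrite mxE.
Qed.

End Glue.

Lemma map_glue (T U : Type) (f : T -> U) n N (k : 'I_n.+1)
    (Y : 'M_(n, N)) (r : 'rV_N) :
  map_mx f (glue k Y r) = glue k (map_mx f Y) (map_mx f r).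
Proof. by apply/matrixP=> a i; rewrite !mxE; case: unlift => [b|]; rewrite ?mxE. Qed.

(** * The system over a commutative ring and Cramer's rule *)

Section System.
Variables (R : comNzRingType) (n N : nat).
Variables (C : 'I_N -> {ffun 'I_n.+1 -> 'I_N.+1} -> R) (t : R).
Implicit Types (X : 'M[R]_(n.+1, N)) (Y : 'M[R]_(n, N)) (r : 'rV[R]_N).

Definition entry0 X (k : 'I_n.+1) (j : 'I_N.+1) : R :=
  if unlift ord0 j is Some i then X k i else 1.

Definition diff_coef (k : 'I_n.+1) : R := (-1) ^+ (n - k) * 'C(n, k)%:R.

Definition difference X i : R := \sum_(k < n.+1) diff_coef k * X k i.

Definition polarized X i : R :=
  \sum_(s : 'S_n.+1) \sum_(j : {ffun 'I_n.+1 -> 'I_N.+1} | nondecr j)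
    C i j * \prod_(k < n.+1) entry0 X k (j (s k)).

(* The i-th equation multiplied by t = h^n. *)
Definition sys X i : R := difference X i - t * polarized X i.

(** Each polarized monomial takes exactly one factor from row [k]; the other factors are frozen. The
    family [X] is arbitrary because [homog_mxE] varies row [k] of a matrix glued along another
    row. *)
Lemma affine_sys (X : 'rV[R]_N -> 'M[R]_(n.+1, N)) k i :
    (forall r b, X r k b = r 0 b) ->
    (forall a r b, a != k -> X r a b = X 0 a b) ->
  affine_row (fun r => sys (X r) i).
Proof.
move=> Xk Xo; apply: affine_rowB.
  apply: affine_row_sum => a; apply: affine_rowM => //.
  have [->|ak] := eqVneq a k; first exact: affine_row_coord (fun r => Xk r i).
  exact: affine_row_const (fun r => Xo a r i ak).
apply: affine_rowM => //; apply: affine_row_sum => s; apply: affine_row_sum => j.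
apply: affine_rowM => //.
apply: (@eq_affine_row _ _ _ (fun r =>
    (\prod_(a < n.+1 | a != k) entry0 (X r) a (j (s a))) * entry0 (X r) k (j (s k)))).
  by move=> r; rewrite (bigD1 k) //= mulrC.
apply: affine_rowM => [r|].
  apply: eq_bigr => a ak; rewrite /entry0; case: unlift => // b; exact: Xo.
rewrite /entry0; case: unlift => [b|]; last exact: affine_row_const.
exact: affine_row_coord (fun r => Xk r b).
Qed.

Lemma affine_sys_glue k Y i : affine_row (fun r => sys (glue k Y r) i).
Proof.
apply: (@affine_sys _ k) => [r b|a r b ak]; first by rewrite glue_at.
by rewrite !mxE; case: unliftP ak => [//|->]; rewrite eqxx.
Qed.

(* Acting on rows: by affinity, the system for the unknown row k given the
   other rows Y reads r *m step_mx k Y = step_cst k Y. *)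
Definition step_cst k Y : 'rV[R]_N := \row_i - sys (glue k Y 0) i.

Definition step_mx k Y : 'M[R]_N :=
  \matrix_(j, i) (sys (glue k Y (delta_mx 0 j)) i - sys (glue k Y 0) i).

Lemma sys_stepP k Y r :
  (forall i, sys (glue k Y r) i = 0) <-> r *m step_mx k Y = step_cst k Y.
Proof.
have E i : sys (glue k Y r) i = (r *m step_mx k Y) 0 i - step_cst k Y 0 i.
  rewrite (affine_sys_glue k Y i r) !mxE opprK addrC; congr (_ + _).
  by apply: eq_bigr => j _; rewrite mxE.
split=> [S0|S0 i]; last by rewrite E S0 subrr.
by apply/rowP=> i; apply/eqP; rewrite -subr_eq0 -E S0.
Qed.

(** Cramer's numerators and denominator are kept apart, without division, so that they exist over
    polynomial rings and commute with ring morphisms. *)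
Definition step_num k Y : 'rV[R]_N := step_cst k Y *m \adj (step_mx k Y).
Definition step_den k Y : R := \det (step_mx k Y).

Lemma step_cramer k Y r : (forall i, sys (glue k Y r) i = 0) ->
  step_num k Y = step_den k Y *: r.
Proof. by rewrite /step_num => /sys_stepP <-; rewrite -mulmxA mul_mx_adj mul_mx_scalar. Qed.

(* [homog_mx k k' Y d w] is d times the matrix of the step for row k' at the
   point whose row k is w / d, written without division. *)
Definition homog_mx k k' Y (d : R) (w : 'rV[R]_N) : 'M[R]_N :=
  let A r := step_mx k' (row' k' (glue k Y r)) in
  d *: A 0 + \sum_j w 0 j *: (A (delta_mx 0 j) - A 0).

(** An entry of the step matrix for row [k'] is a difference of two values of the system, both
    affine in row [k]; multiplying the affine expansion by [d] gives the formula. *)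
Lemma homog_mxE k k' Y r d : k != k' ->
  homog_mx k k' Y d (d *: r) = d *: step_mx k' (row' k' (glue k Y r)).
Proof.
move=> kk'; apply/matrixP=> j i.
have aff u : affine_row (fun r => sys (glue k' (row' k' (glue k Y r)) u) i).
  have [b kE] : exists b, k = lift k' b.
    by case: (unliftP k' k) => [b|] E; [exists b|rewrite E eqxx in kk'].
  apply: (@affine_sys _ k) => [q a|a q c ak].
    by rewrite [in LHS]kE glue_lift mxE -kE glue_at.
  case: (unliftP k' a) => [e|] aE; rewrite aE ?glue_lift ?glue_at //.
  rewrite !mxE -aE; case: (unliftP k a) => [//|E]; by rewrite E eqxx in ak.
have := affine_rowB (aff (delta_mx 0 j)) (aff 0) r.
rewrite /homog_mx !mxE summxE => -> /=; rewrite [RHS]mulrDr mulr_sumr; congr (_ + _).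
by apply: eq_bigr => a _; rewrite !mxE mulrA.
Qed.

(** The determinant of the step for row [k'] at the solution of the step for row [k], with
    denominators cleared: it is polynomial in the data and can be specialized. *)
Definition good_den k k' Y : R :=
  \det (homog_mx k k' Y (step_den k Y) (step_num k Y)).

Lemma good_denE k k' Y r : k != k' -> (forall i, sys (glue k Y r) i = 0) ->
  good_den k k' Y = step_den k Y ^+ N * step_den k' (row' k' (glue k Y r)).
Proof. by move=> kk' /step_cramer numE; rewrite /good_den numE homog_mxE // detZ. Qed.

End System.

(** * Compatibility with ring morphisms *)

Section Naturality.
Variables (R S : comNzRingType) (f : {rmorphism R -> S}) (n N : nat).
Variables (C : 'I_N -> {ffun 'I_n.+1 -> 'I_N.+1} -> R) (t : R).
Variables (C' : 'I_N -> {ffun 'I_n.+1 -> 'I_N.+1} -> S) (t' : S).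
Hypotheses (fC : forall i j, f (C i j) = C' i j) (ft : f t = t').

Lemma rmorph_sys X i : f (sys C t X i) = sys C' t' (map_mx f X) i.
Proof.
rewrite /sys rmorphB rmorphM ft; congr (_ - _ * _).
  rewrite rmorph_sum; apply: eq_bigr => k _.
  by rewrite !rmorphM rmorphXn rmorphN1 rmorph_nat mxE.
rewrite rmorph_sum; apply: eq_bigr => s _.
rewrite rmorph_sum; apply: eq_bigr => j _.
rewrite rmorphM fC rmorph_prod; congr (_ * _); apply: eq_bigr => k _.
by rewrite /entry0; case: unlift => [b|]; rewrite ?mxE ?rmorph1.
Qed.

Lemma map_step_mx k Y : map_mx f (step_mx C t k Y) = step_mx C' t' k (map_mx f Y).
Proof.
by apply/matrixP=> j i; rewrite !mxE rmorphB !rmorph_sys !map_glue map_delta_mx map_mx0.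
Qed.

Lemma map_step_cst k Y : map_mx f (step_cst C t k Y) = step_cst C' t' k (map_mx f Y).
Proof. by apply/rowP=> i; rewrite !mxE rmorphN rmorph_sys map_glue map_mx0. Qed.

Lemma map_step_num k Y : map_mx f (step_num C t k Y) = step_num C' t' k (map_mx f Y).
Proof. by rewrite map_mxM map_mx_adj map_step_cst map_step_mx. Qed.

Lemma rmorph_step_den k Y : f (step_den C t k Y) = step_den C' t' k (map_mx f Y).
Proof. by rewrite -det_map_mx map_step_mx. Qed.

Lemma map_homog_mx k k' Y d w :
  map_mx f (homog_mx C t k k' Y d w) =
    homog_mx C' t' k k' (map_mx f Y) (f d) (map_mx f w).
Proof.
have A r : map_mx f (step_mx C t k' (row' k' (glue k Y r))) =
    step_mx C' t' k' (row' k' (glue k (map_mx f Y) (map_mx f r))).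
  by rewrite map_step_mx -map_glue; congr step_mx; apply/matrixP=> a i; rewrite !mxE.
rewrite /homog_mx map_mxD map_mxZ A map_mx0 map_mx_sum; congr (_ + _).
by apply: eq_bigr => j _; rewrite map_mxZ map_mxB !A map_delta_mx map_mx0 mxE.
Qed.

Lemma rmorph_good_den k k' Y :
  f (good_den C t k k' Y) = good_den C' t' k k' (map_mx f Y).
Proof. by rewrite -det_map_mx map_homog_mx rmorph_step_den map_step_num. Qed.

End Naturality.

(** * Specialization at t = 0 *)

Section ZeroStep.
Variables (R : comNzRingType) (n N : nat).
Variables (C : 'I_N -> {ffun 'I_n.+1 -> 'I_N.+1} -> R).

(** Only the difference operator survives, and it acts on each coordinate separately. *)
Lemma step_mx0 k Y : step_mx C 0 k Y = (diff_coef R k)%:M.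
Proof.
have E r i : sys C 0 (glue k Y r) i =
    diff_coef R k * r 0 i + \sum_(a < n.+1 | a != k) diff_coef R a * glue k Y 0 a i.
  rewrite /sys mul0r subr0 /difference (bigD1 k) //= glue_at; congr (_ + _).
  apply: eq_bigr => a ak; congr (_ * _); rewrite !mxE.
  by case: unliftP ak => [//|->]; rewrite eqxx.
apply/matrixP=> j i; rewrite !mxE !E !mxE mulr0 add0r addrK eqxx /=.
by rewrite eq_sym mulr_natr.
Qed.

Lemma step_cst0 k : step_cst C 0 k 0 = 0.
Proof.
apply/rowP=> i; rewrite !mxE /sys mul0r subr0 /difference big1 ?oppr0 // => a _.
by rewrite !mxE; case: unlift => [b|]; rewrite ?mxE mulr0.
Qed.

Lemma step_den0 k Y : step_den C 0 k Y = diff_coef R k ^+ N.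
Proof. by rewrite /step_den step_mx0 det_scalar. Qed.

(** With all other rows 0, the zero row solves the step, so [good_denE] applies. *)
Lemma good_den0 k k' : k != k' ->
  good_den C 0 k k' 0 = (diff_coef R k ^+ N) ^+ N * diff_coef R k' ^+ N.
Proof.
move=> kk'; rewrite (@good_denE _ _ _ _ _ _ _ _ 0) ?step_den0 //.
by apply/sys_stepP; rewrite mul0mx step_cst0.
Qed.

End ZeroStep.

(** * Roots, signed binomials and division over a field *)

Lemma roots_in_seq (F : fieldType) (p : {poly F}) :
  p != 0 -> exists s : seq F, forall a, root p a -> a \in s.
Proof.
have [m] := ubnP (size p); elim: m p => // m IHm p sz_p p0.
(* Having a root need not be decidable over [F], hence the classical case split; a root is then
   factored out to lower the degree. *)
have [[a pa]|no_root] := classic (exists a, root p a); last first.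
  by exists [::] => a pa; case: no_root; exists a.
have [q pE] := factor_theorem p a pa.
have q0 : q != 0 by apply: contraNneq p0 => q0; rewrite pE q0 mul0r.
have [|s sP] := IHm q _ q0.
  by move: sz_p; rewrite pE size_Mmonic ?monicXsubC // size_XsubC addn2.
exists (a :: s) => b; rewrite pE rootM root_XsubC in_cons => /orP[/sP ->|->] //.
by rewrite orbT.
Qed.

Lemma diff_coef_neq0 (F : fieldType) (n : nat) (k : 'I_n.+1) :
  [pchar F] =i pred0 -> diff_coef F k != 0.
Proof.
move=> /pcharf0P F0; rewrite mulf_neq0 ?signr_eq0 // F0 -lt0n bin_gt0.
by rewrite -ltnS ltn_ord.
Qed.

HB.instance Definition _ (F : fieldType) d :=
  GRing.RMorphism.copy (@ratconst F d) (@FracField.tofrac _ \o @mpolyC d F).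
HB.instance Definition _ (F : fieldType) d :=
  GRing.RMorphism.copy (@ratpoly F d) (@FracField.tofrac _).

Section FieldStep.
Variables (L : fieldType) (n N : nat).
Variables (C : 'I_N -> {ffun 'I_n.+1 -> 'I_N.+1} -> L) (t : L).

Lemma step_solution k Y r : step_den C t k Y != 0 ->
  (forall i, sys C t (glue k Y r) i = 0) <->
    r = (step_den C t k Y)^-1 *: step_num C t k Y.
Proof.
move=> D0; split=> [/step_cramer ->|->]; first by rewrite scalerA mulVf ?scale1r.
apply/sys_stepP; rewrite -scalemxAl /step_num -mulmxA mul_adj_mx mul_mx_scalar.
by rewrite scalerA mulVf ?scale1r.
Qed.

End FieldStep.

(** * Linearity of the equations in each shift *)

Lemma linear_in_shiftD (F : fieldType) n N k (p q : {mpoly F[n.+1 * N]}) :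
  linear_in_shift k p -> linear_in_shift k q -> linear_in_shift k (p + q).
Proof.
by move=> pL qL m /msuppD_le; rewrite mem_cat => /orP[/pL|/qL].
Qed.

Lemma linear_in_shiftZ (F : fieldType) n N k (a : F) (p : {mpoly F[n.+1 * N]}) :
  linear_in_shift k p -> linear_in_shift k (a *: p).
Proof. by move=> pL m /msuppZ_le /pL. Qed.

Lemma linear_in_shift_sum (F : fieldType) n N k (I : Type) (s : seq I) (P : pred I)
    (p : I -> {mpoly F[n.+1 * N]}) :
  (forall i, linear_in_shift k (p i)) ->
  linear_in_shift k (\sum_(i <- s | P i) p i).
Proof.
move=> pL; apply: big_ind => //; last exact: linear_in_shiftD.
by move=> m; rewrite msupp0.
Qed.

(** The product is a single monomial, and only its factor [a = k] can involve row [k], with degree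
    at most 1. *)
Lemma linear_in_shift_prod (F : fieldType) n N k
    (j : 'I_n.+1 -> 'I_N.+1) :
  linear_in_shift k (\prod_(a < n.+1) shift_var0 F a (j a)).
Proof.
pose e a : 'X_{1..n.+1 * N} :=
  if unlift ord0 (j a) is Some i then U_(mxvec_index a i)%MM else 0%MM.
rewrite (eq_bigr (fun a => 'X_[e a])) => [|a _]; last first.
  by rewrite /shift_var0 /e; case: unlift => [i|]; rewrite ?mpolyX0.
rewrite mprodXE => m; rewrite msuppX inE => /eqP ->.
rewrite (eq_bigr _ (fun i _ => mnm_sumE (mxvec_index k i) _ _ e)).
rewrite exchange_big (bigD1 k) //= [X in (_ + X)%N]big1 ?addn0 => [|a ak].
  rewrite /e; case: unlift => [i|]; last by rewrite big1 // => i _; rewrite mnm0E.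
  rewrite (bigD1 i) //= big1 ?addn0 => [|b bi]; first by rewrite mnmE eqxx.
  (* Injectivity of [mxvec_index]: equal indices would give equal unit matrices. *)
  rewrite mnm1E; case: eqP => // /(congr1 (fun v => vec_mx (delta_mx 0 v : 'rV[F]_(_)))).
  rewrite !vec_mx_delta => /matrixP /(_ k b) /eqP.
  by rewrite !mxE !eqxx (negPf bi) eq_sym oner_eq0.
rewrite big1 // => i _; rewrite /e; case: unlift => [b|]; last by rewrite mnm0E.
rewrite mnm1E; case: eqP => // /(congr1 (fun v => vec_mx (delta_mx 0 v : 'rV[F]_(_)))).
rewrite !vec_mx_delta => /matrixP /(_ k i) /eqP; rewrite !mxE !eqxx.
by rewrite [k == a]eq_sym (negPf ak) eq_sym oner_eq0.
Qed.

Lemma linear_in_shift_system (F : fieldType) n N c (h : F) (i : 'I_N) k :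
  linear_in_shift k (diff_lhs n h i - polarized_rhs c i).
Proof.
rewrite -scaleN1r; apply: linear_in_shiftD; last apply: linear_in_shiftZ.
  apply/linear_in_shiftZ/linear_in_shift_sum => a; apply: linear_in_shiftZ.
  rewrite /shift_var.
  (* A single variable is a product in which every other factor is the dummy 1. *)
  move: (@linear_in_shift_prod F n N k (fun b => if b == a then lift ord0 i else ord0)).
  rewrite (bigD1 a) //= big1 => [|b /negPf ba]; last by rewrite /shift_var0 ba unlift_none.
  by rewrite mulr1 /shift_var0 eqxx liftK.
apply/linear_in_shiftZ/linear_in_shift_sum => s; apply: linear_in_shift_sum => j.
apply: linear_in_shiftZ; exact: (@linear_in_shift_prod F n N k (fun a => j (s a))).
Qed.

(** * Solutions at the generic point and their composition *)

Section Birational.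
Variables (F : fieldType) (n N : nat).
Variables (c : 'I_N -> {ffun 'I_n.+1 -> 'I_N.+1} -> F) (h : F).

(** The factor 1/(n+1)! is absorbed into the coefficients. *)
Definition fact_coef i j : F := ((n.+1)`!%:R)^-1 * c i j.
Local Notation d := (n * N)%N.
Local Notation K := (ratfun F d).
Local Notation coefK := (fun i j => ratconst d (fact_coef i j)).
Local Notation tK := (ratconst d (h ^+ n)).
Local Notation coefP := (fun i j => (fact_coef i j)%:MP_[d]).
Local Notation tP := ((h ^+ n)%:MP_[d]).
Local Notation genP := (\matrix_(k, i) 'X_(mxvec_index k i) : 'M[{mpoly F[d]}]_(n, N)).
Local Notation gen := (generic_rows F n N).

Lemma solvesP (x : 'M[K]_(n.+1, N)) : h != 0 ->
  solves c h x <-> (forall i, sys coefK tK x i = 0).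
Proof.
move=> h0; have hK0 : tK != 0 by rewrite fmorph_eq0 expf_neq0.
have lhsE i : poly_at (diff_lhs n h i) (mxvec x) = tK^-1 * difference x i.
  rewrite /poly_at mmapZ fmorphV rmorph_sum; congr (_ * _).
  apply: eq_bigr => k _; rewrite /= mmapZ rmorphM rmorphXn rmorphN1 rmorph_nat.
  by rewrite mmapX mmap1U mxvecE.
have rhsE i : poly_at (polarized_rhs c i) (mxvec x) = polarized coefK x i.
  rewrite /poly_at mmapZ rmorph_sum mulr_sumr; apply: eq_bigr => s _.
  rewrite rmorph_sum mulr_sumr; apply: eq_bigr => j _.
  rewrite /= mmapZ mulrA -rmorphM rmorph_prod; congr (_ * _); apply: eq_bigr => k _.
  rewrite /= /shift_var0 /entry0; case: unlift => [b|]; last by rewrite rmorph1.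
  by rewrite mmapX mmap1U mxvecE.
split=> E i; last first.
  rewrite lhsE rhsE; apply: (mulfI hK0); rewrite mulVKf //.
  by apply/eqP; rewrite -subr_eq0 -[X in X == _]/(sys coefK tK x i) E.
by rewrite /sys -rhsE -E lhsE mulVKf // subrr.
Qed.

Lemma map_genP (phi : 'M[K]_(n, N)) :
  map_mx (mmap (ratconst d) (fun v => mxvec phi 0 v)) genP = phi.
Proof. by apply/matrixP=> k i; rewrite !mxE mmapX mmap1U mxvecE. Qed.

Lemma ratpoly_genP : map_mx (@ratpoly F d) genP = gen.
Proof. by apply/matrixP=> k i; rewrite !mxE. Qed.

Lemma meval_genP : map_mx (meval (fun=> 0 : F)) genP = 0.
Proof. by apply/matrixP=> k i; rewrite !mxE mevalXU. Qed.

(** A polynomial with nonzero value at the origin is nonzero, and polynomials embed in their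
    fraction field. *)
Lemma step_den_generic k : step_den fact_coef (h ^+ n) k 0 != 0 ->
  step_den coefK tK k gen != 0.
Proof.
rewrite -meval_genP -(rmorph_step_den (C := coefP) (t := tP)); last 2 first.
- exact: (fun i j => mevalC _ _).
- exact: mevalC.
move=> D0; rewrite -ratpoly_genP.
rewrite -(rmorph_step_den (f := @ratpoly F d) (C := coefP) (t := tP)) //.
by rewrite tofrac_eq0; apply: contraNneq D0 => ->; rewrite rmorph0.
Qed.

Lemma good_den_generic k k' : good_den fact_coef (h ^+ n) k k' 0 != 0 ->
  good_den coefK tK k k' gen != 0.
Proof.
rewrite -meval_genP -(rmorph_good_den (C := coefP) (t := tP)); last 2 first.
- exact: (fun i j => mevalC _ _).
- exact: mevalC.
move=> D0; rewrite -ratpoly_genP.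
rewrite -(rmorph_good_den (f := @ratpoly F d) (C := coefP) (t := tP)) //.
by rewrite tofrac_eq0; apply: contraNneq D0 => ->; rewrite rmorph0.
Qed.

Definition solution k : 'M[K]_(n.+1, N) :=
  glue k gen ((step_den coefK tK k gen)^-1 *: step_num coefK tK k gen).

Lemma sys_solution k : step_den coefK tK k gen != 0 ->
  forall i, sys coefK tK (solution k) i = 0.
Proof. by move=> D0; apply/step_solution. Qed.

Lemma solution_unique k : h != 0 -> step_den coefK tK k gen != 0 ->
  unique (fun x => row' k x = gen /\ solves c h x) (solution k).
Proof.
move=> h0 D0; split=> [|x [xE /solvesP S]].
  by split; [exact: row'_glue|apply/solvesP => //; apply: sys_solution].
rewrite -(glue_row' k x) xE; congr glue; apply/esym/step_solution => // i.
by rewrite -xE glue_row'; exact: S.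
Qed.

(** Solving for row [k] and then for row [k'] from the resulting rows recovers the original row
    [k'], by uniqueness in Cramer's rule; the other components merely relabel coordinates. *)
Lemma solution_comp k k' a i : k != k' ->
    step_den coefK tK k gen != 0 -> good_den coefK tK k k' gen != 0 ->
  ratcomp_is (solution k' (lift k a) i) (mxvec (row' k' (solution k)))
    (ratvar F (mxvec_index a i)).
Proof.
move=> kk' D0 G0; have solX := sys_solution D0.
have varE b e : solution e (lift e b) i = ratvar F (mxvec_index b i).
  by rewrite /solution glue_lift mxE.
have [b aE|aE] := unliftP k' (lift k a).
  exists 'X_(mxvec_index b i), 1; rewrite /ratpoly /poly_at tofrac1 rmorph1 oner_neq0.
  by split=> //; rewrite divr1 ?aE ?varE // mmapX mmap1U mxvecE mxE -aE varE.
set Y' := row' k' (solution k).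
(* The second denominator does not vanish on the image of the first map, as it is a factor of
   [good_den]. *)
have D'0 : step_den coefK tK k' Y' != 0.
  by apply: contraNneq G0 => D'0; rewrite (good_denE kk' solX) -/Y' D'0 mulr0.
(* The same polynomial numerator and denominator serve twice: [f] substitutes [Y'] in them, while
   [g] below embeds them as a fraction. *)
pose f : {rmorphism {mpoly F[d]} -> K} := mmap (ratconst d) (fun v => mxvec Y' 0 v).
have fC i0 j : f (coefP i0 j) = coefK i0 j by exact: mmapC.
have ft : f tP = tK by exact: mmapC.
have denE : f (step_den coefP tP k' genP) = step_den coefK tK k' Y'.
  by rewrite (rmorph_step_den fC ft) map_genP.
have numE : f (step_num coefP tP k' genP 0 i) = step_num coefK tK k' Y' 0 i.
  by have /matrixP/(_ 0 i) := map_step_num fC ft k' genP; rewrite map_genP mxE.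
pose g : {rmorphism {mpoly F[d]} -> K} := @ratpoly F d.
have gC i0 j : g (coefP i0 j) = coefK i0 j by [].
have gt : g tP = tK by [].
have denG : g (step_den coefP tP k' genP) = step_den coefK tK k' gen.
  by have := rmorph_step_den gC gt k' genP; rewrite ratpoly_genP.
have numG : g (step_num coefP tP k' genP 0 i) = step_num coefK tK k' gen 0 i.
  by have /matrixP/(_ 0 i) := map_step_num gC gt k' genP; rewrite ratpoly_genP mxE.
exists (step_num coefP tP k' genP 0 i), (step_den coefP tP k' genP).
split; last 2 first.
- by rewrite -[poly_at _ _]/(f _) denE.
- rewrite -[poly_at (step_num _ _ _ _ _ _) _]/(f _) -[poly_at _ _]/(f _) denE numE.
  rewrite (step_cramer (r := row k' (solution k))); last by move=> i0; rewrite glue_row'.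
  by rewrite mxE [row _ _ _ _]mxE mulrC mulKf // -aE varE.
by rewrite aE glue_at mxE mulrC -denG -numG.
Qed.

End Birational.

(** * Excluded time steps and conclusion *)

Lemma good_steps (F : fieldType) (charF0 : [pchar F] =i pred0) n N
    (a : 'I_N -> {ffun 'I_n.+1 -> 'I_N.+1} -> F) (k k' : 'I_n.+1) :
    (0 < n)%N -> k != k' ->
  exists bad : seq F, forall h, h \notin bad ->
    step_den a (h ^+ n) k 0 != 0 /\ good_den a (h ^+ n) k k' 0 != 0.
Proof.
move=> n0 kk'; pose aX i j : {poly F} := (a i j)%:P.
(* The time step becomes an indeterminate; the excluded values are the roots of [P]. *)
pose P := step_den aX 'X^n k 0 * good_den aX 'X^n k k' 0.
have PE h : P.[h] = step_den a (h ^+ n) k 0 * good_den a (h ^+ n) k k' 0.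
  pose ev : {rmorphism {poly F} -> F} := horner_eval h.
  have evC i j : ev (aX i j) = a i j by exact: hornerC.
  have evt : ev 'X^n = h ^+ n by exact: hornerXn.
  rewrite -[P.[h]]/(ev P) rmorphM.
  by rewrite (rmorph_step_den evC evt) (rmorph_good_den evC evt) !map_mx0.
have P0 : P.[0] != 0.
  (* Since n > 0, h = 0 gives t = 0. *)
  rewrite PE expr0n eqn0Ngt n0 step_den0 good_den0 //.
  by rewrite !mulf_neq0 ?expf_neq0 ?diff_coef_neq0.
have [|bad badP] := @roots_in_seq F P.
  by apply: contraNneq P0 => ->; rewrite horner0.
exists bad => h hbad; have : P.[h] != 0 by apply: contra hbad => /badP.
by rewrite PE mulf_eq0 negb_or => /andP.
Qed.

Theorem mainTheorem1 (F : fieldType) (charF0 : [pchar F] =i pred0)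
    (n N : nat) (n_gt0 : (0 < n)%N) (N_gt0 : (0 < N)%N)
    (c : 'I_N -> {ffun 'I_n.+1 -> 'I_N.+1} -> F) :
  (forall (h : F) (i : 'I_N),
     linear_in_shift ord_max (diff_lhs n h i - polarized_rhs c i) /\
     linear_in_shift ord0 (diff_lhs n h i - polarized_rhs c i)) /\
  exists bad : seq F, forall h : F, h != 0 -> h \notin bad ->
    exists x z : 'M[ratfun F (n * N)]_(n.+1, N),
      [/\ unique (fun x' => lower_shifts x' = generic_rows F n N /\ solves c h x') x,
          unique (fun z' => upper_shifts z' = generic_rows F n N /\ solves c h z') z,
          birational (mxvec (upper_shifts x))
        & rational_inverse (mxvec (upper_shifts x)) (mxvec (lower_shifts z))].
Proof.
split=> [h i|]; first by split; apply: linear_in_shift_system.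
(* The lowest and highest shifts differ because n > 0. *)
have k01 : (ord0 : 'I_n.+1) != ord_max by rewrite -val_eqE /= eq_sym -lt0n.
have k10 : (ord_max : 'I_n.+1) != ord0 by rewrite eq_sym.
have [bad0 bad0P] := good_steps charF0 (fact_coef c) n_gt0 k01.
have [bad1 bad1P] := good_steps charF0 (fact_coef c) n_gt0 k10.
exists (bad0 ++ bad1) => h h0; rewrite mem_cat negb_or => /andP[/bad0P + /bad1P].
move=> [/step_den_generic D0 /good_den_generic G0].
move=> [/step_den_generic D1 /good_den_generic G1].
have inv : rational_inverse (mxvec (upper_shifts (solution c h ord_max)))
    (mxvec (lower_shifts (solution c h ord0))).
  (* Both composites are instances of [solution_comp], with the extreme rows exchanged. *)
  by split=> v; case/mxvec_indexP: v => a i; rewrite mxvecE mxE; apply: solution_comp.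
exists (solution c h ord_max), (solution c h ord0); split=> //.
- exact: solution_unique.
- exact: solution_unique.
- by exists (mxvec (lower_shifts (solution c h ord0))).
Qed.
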